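(* Let $R$ be a Mori domain. Then: (1) $R$ is Clifford $t$-regular (respectively, $t$-stable, $w$-stable) if and only if $R_M$ is Clifford $t_M$-regular (respectively, $t_M$-stable, stable) for each $M\in t\text{-}\mathrm{Max}(R)$, where $t_M$ denotes the $t$-operation of $R_M$. (2) If $R$ is Clifford $w$-regular, then $R_M$ is Clifford regular for each $M\in t\text{-}\mathrm{Max}(R)$. If, in addition, $R$ is strong Mori, then $R$ is Clifford $w$-regular if and only if $R_M$ is Clifford regular for each $M\in t\text{-}\mathrm{Max}(R)$.
   Context: Let $R$ be an integral domain with field of fractions $K$. An ideal of $R$ means a nonzero fractional ideal; it is integral if it is contained in $R$. For $R$-submodules $I,J$ of $K$, $(J:I):=\{x\in K: xI\subseteq J\}$, and $E(I):=(I:I)$. For an ideal $I$: $I^d:=I$; $I^v:=(R:(R:I))$; $I^t:=\bigcup\{J^v : J\subseteq I \text{ a finitely generated ideal}\}$; $I^w:=\bigcap_{M\in t\text{-}\mathrm{Max}(R)}IR_M$. For $\ast\in\{d,w,t,v\}$ a $\ast$-ideal is an ideal with $I=I^\ast$; $t\text{-}\mathrm{Max}(R)$ is the set of maximal elements among the proper integral $t$-ideals (they are prime). A domain is Mori if it satisfies the ascending chain condition on integral $v$-ideals (equivalently, integral $t$-ideals), and strong Mori if it satisfies the ascending chain condition on integral $w$-ideals. For $\ast\in\{d,w,t\}$: an ideal $I$ is (Clifford) $\ast$-regular if $I^\ast=(I^2J)^\ast$ for some ideal $J$ of $R$; $I$ is $\ast$-stable if, with $E:=E(I^\ast)$, $(I^\ast(E:I^\ast))^\ast=E$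 ($\ast$ being the operation of $R$; fractional ideals of $E$ are fractional ideals of $R$). $R$ is Clifford $\ast$-regular (respectively $\ast$-stable) if every ideal of $R$ is. ''Clifford regular'' and ''stable'' mean Clifford $d$-regular and $d$-stable. *)

(* Defs.v *)
From mathcomp Require Import all_boot all_algebra.
From mathcomp Require Import boolp classical_sets.

Set Implicit Arguments.
Unset Strict Implicit.
Unset Printing Implicit Defensive.

Import GRing.Theory.

Local Open Scope classical_set_scope.
Local Open Scope ring_scope.

(* R, its localizations R_M and its overrings E(I) are all handled as subsets
   of the same field K: in every notion below, D stands for the subring of K,
   with field of fractions K, that plays the role of the base domain. In
   particular t_op (loc D M) is the t-operation of D_M itself. *)

Section Ideals.
Variable K : fieldType.
Implicit Types D I J M : set K.

(* nonzero fractional ideal of D *)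
Definition is_ideal D I : Prop :=
  [/\ [/\ I 0, forall x y, I x -> I y -> I (x + y)
        & forall a x, D a -> I x -> I (a * x)],
      exists2 x, I x & x != 0
    & exists2 d, D d /\ d != 0 & forall x, I x -> D (d * x)].

Definition span D n (g : 'I_n -> K) : set K :=
  [set x | exists2 c : 'I_n -> K, (forall i, D (c i))
                                & x = \sum_(i < n) c i * g i].

Definition is_fg_ideal D J : Prop :=
  is_ideal D J /\ exists (n : nat) (g : 'I_n -> K), J = span D g.

Definition idealM I J : set K :=
  [set x | exists (n : nat) (a b : 'I_n -> K),
     [/\ forall i, I (a i), forall i, J (b i) & x = \sum_(i < n) a i * b i]].

(* colon J I = (J : I) *)
Definition colon J I : set K := [set x | forall y, I y -> J (x * y)].

Definition endo I : set K := colon I I.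

(* the localization D_M, for a prime M of D *)
Definition loc D M : set K :=
  [set x | exists a s, [/\ D a, D s, ~ M s & x = a / s]].

Definition d_op D I : set K := I.

Definition v_op D I : set K := colon D (colon D I).

Definition t_op D I : set K :=
  \bigcup_(J in [set J | is_fg_ideal D J /\ J `<=` I]) v_op D J.

Definition is_star_ideal (op : set K -> set K -> set K) D I : Prop :=
  is_ideal D I /\ I = op D I.

Definition is_integral_star_ideal (op : set K -> set K -> set K) D I : Prop :=
  is_star_ideal op D I /\ I `<=` D.

Definition is_proper_integral_t_ideal D I : Prop :=
  is_integral_star_ideal t_op D I /\ I <> D.

Definition t_Max D : set (set K) :=
  [set M | is_proper_integral_t_ideal D M /\
           forall J, is_proper_integral_t_ideal D J -> M `<=` J -> J = M].

(* idealM I (loc D M) is the extension I D_M *)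
Definition w_op D I : set K := \bigcap_(M in t_Max D) idealM I (loc D M).

Definition acc (P : set K -> Prop) : Prop :=
  forall I : nat -> set K, (forall n, P (I n)) ->
    (forall n, I n `<=` I n.+1) ->
    exists N, forall n, (N <= n)%N -> I n = I N.

Definition mori D : Prop := acc (is_integral_star_ideal v_op D).

Definition strong_mori D : Prop := acc (is_integral_star_ideal w_op D).

Definition star_regular (op : set K -> set K -> set K) D I : Prop :=
  exists2 J, is_ideal D J & op D I = op D (idealM (idealM I I) J).

Definition clifford_regular (op : set K -> set K -> set K) D : Prop :=
  forall I, is_ideal D I -> star_regular op D I.

Definition star_stable_ideal (op : set K -> set K -> set K) D I : Prop :=
  let E := endo (op D I) in
  op D (idealM (op D I) (colon E (op D I))) = E.

Definition star_stable (op : set K -> set K -> set K) D : Prop :=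
  forall I, is_ideal D I -> star_stable_ideal op D I.

End Ideals.

Arguments d_op {K} D I.
Arguments v_op {K} D I.
Arguments t_op {K} D I.
Arguments w_op {K} D I.

Definition base_domain (R : idomainType) : set {fraction R} :=
  range (@FracField.tofrac R).
Arguments base_domain R _ : clear implicits.

(* Main.v *)
(* With Q = (I^* : I^2), an ideal I is *-regular iff I is contained in
   (I^2 Q)^*, and *-stable iff 1 lies in (I Q)^*. Both conditions can be tested
   at the t-maximal ideals M as soon as the star operation commutes with
   localization at M and (I^* : I^2) R_M = (I^* R_M : I^2 R_M); only the
   implications from local to global need the latter. For t over a Mori domain,
   and for w over a strong Mori domain, it holds because I^2 has the same
   closure as a finitely generated ideal J contained in it. For w-stability over
   a Mori domain it comes instead from the finite character of t-maximal ideals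
   and from the stability of every I R_N, which makes I R_N finitely generated
   over its endomorphism ring. *)

Require Import Defs.
From mathcomp Require Import all_boot all_algebra.
From mathcomp Require Import boolp classical_sets.
From mathcomp Require Import ring.

Set Implicit Arguments.
Unset Strict Implicit.
Unset Printing Implicit Defensive.

Import GRing.Theory.

Local Open Scope classical_set_scope.
Local Open Scope ring_scope.

(* [span] is also a constant of mathcomp's vector library. *)
Local Notation span := Defs.span.

(** * Submodules of K: products, colons and spans *)

Section Modules.
Variable K : fieldType.
Implicit Types (D I J M A B : set K) (x y s : K).

Definition submod D A : Prop :=
  [/\ A 0, forall x y, A x -> A y -> A (x + y)
    & forall a x, D a -> A x -> A (a * x)].

Definition subring_with_fractions D : Prop :=
  [/\ D 0, D 1, forall x y, D x -> D y -> D (x + y),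
      forall x y, D x -> D y -> D (x * y)
    & forall x, exists a s, [/\ D a, D s, s != 0 & x = a / s]].

Lemma ideal_submod D I : is_ideal D I -> submod D I.
Proof. by case. Qed.

Lemma submod_sum D A n (f : 'I_n -> K) :
  submod D A -> (forall i, A (f i)) -> A (\sum_(i < n) f i).
Proof.
by case=> A0 AD _ Af; elim/big_ind: _ => // i _; apply: Af.
Qed.

Lemma mem_idealM I J x y : I x -> J y -> idealM I J (x * y).
Proof.
move=> Ix Jy; exists 1%N, (fun=> x), (fun=> y); split=> //.
by rewrite big_ord1.
Qed.

Lemma idealM_sub D A I J : submod D A ->
  (forall x y, I x -> J y -> A (x * y)) -> idealM I J `<=` A.
Proof.
move=> mA AIJ z [n [a [b [Ia Jb ->]]]]; apply: (submod_sum mA) => i.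
exact: AIJ.
Qed.

Lemma idealM_mono I J I' J' : I `<=` I' -> J `<=` J' ->
  idealM I J `<=` idealM I' J'.
Proof.
by move=> sI sJ z [n [a [b [Ia Jb ->]]]]; exists n, a, b; split=> // i; auto.
Qed.

Lemma idealM_add I J x y :
  idealM I J x -> idealM I J y -> idealM I J (x + y).
Proof.
move=> [n [a [b [Ia Jb ->]]]] [m [a' [b' [Ia' Jb' ->]]]].
exists (n + m)%N,
  (fun k => match split k with inl i => a i | inr j => a' j end),
  (fun k => match split k with inl i => b i | inr j => b' j end).
split; [by move=> k; case: (split k)..|].
rewrite big_split_ord /=; congr (_ + _); apply: eq_bigr => i _.
  by rewrite (unsplitK (inl i)).
by rewrite (unsplitK (inr i)).
Qed.

Lemma submod_idealM D I J : submod D I -> submod D (idealM I J).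
Proof.
move=> [_ _ Iz]; split; last 1 first.
- move=> c _ Dc [n [a [b [Ia Jb ->]]]]; exists n, (fun i => c * a i), b.
  split=> // [i|]; first exact: Iz.
  by rewrite mulr_sumr; apply: eq_bigr => i _; rewrite mulrA.
- by exists 0%N, (fun=> 0), (fun=> 0); split=> [[]//|[]//|]; rewrite big_ord0.
- by move=> x y; apply: idealM_add.
Qed.

Lemma submod_colon D I J : submod D J -> submod D (colon J I).
Proof.
move=> [J0 JD JM]; split=> [y _|x x' Hx Hx' y Iy|a x Da Hx y Iy].
- by rewrite mul0r.
- by rewrite mulrDl; apply: JD; [apply: Hx|apply: Hx'].
- by rewrite -mulrA; apply: JM => //; apply: Hx.
Qed.

Lemma submod_preim_mul D A a : submod D A -> submod D [set x | A (x * a)].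
Proof.
move=> [A0 AD AM]; split=> /= [|x y Ax Ay|b x Db Ax].
- by rewrite mul0r.
- by rewrite mulrDl; exact: AD.
- by rewrite -mulrA; exact: AM.
Qed.

Lemma submod_preim_mull D A a : submod D A -> submod D [set x | A (a * x)].
Proof.
move=> mA; have := submod_preim_mul a mA.
by congr submod; apply/seteqP; split=> x /=; rewrite mulrC.
Qed.

Lemma submod_span D n (g : 'I_n -> K) :
  subring_with_fractions D -> submod D (span D g).
Proof.
case=> D0 _ DD DM _; split=> [|x y [c Dc ->] [c' Dc' ->]|a x Da [c Dc ->]].
- by exists (fun=> 0) => //; rewrite big1 // => i _; rewrite mul0r.
- exists (fun i => c i + c' i) => [i|]; first exact: DD.
  by rewrite -big_split; apply: eq_bigr => i _; rewrite mulrDl.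
- exists (fun i => a * c i) => [i|]; first exact: DM.
  by rewrite mulr_sumr; apply: eq_bigr => i _; rewrite mulrA.
Qed.

Lemma span_sub D A n (g : 'I_n -> K) :
  submod D A -> (forall i, A (g i)) -> span D g `<=` A.
Proof.
move=> mA Ag x [c Dc ->]; apply: (submod_sum mA) => i.
by case: mA => _ _; apply.
Qed.

Lemma mem_span D n (g : 'I_n -> K) i :
  subring_with_fractions D -> span D g (g i).
Proof.
case=> D0 D1 _ _ _; exists (fun j => (j == i)%:R) => [j|].
  by case: (j == i).
rewrite (bigD1 i) //= eqxx mul1r big1 ?addr0 // => j /negPf ->.
by rewrite mul0r.
Qed.

End Modules.

(** * Fractional ideals and abstract star operations *)

Section FractionalIdeals.
Variable K : fieldType.
Variable D : set K.
Hypothesis hD : subring_with_fractions D.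
Implicit Types (I J M A B : set K) (x y s : K).

Let D0 : D 0. Proof. by case: hD. Qed.
Let D1 : D 1. Proof. by case: hD. Qed.
Let DD x y : D x -> D y -> D (x + y). Proof. by case: hD => _ _ + _ _; apply. Qed.
Let DM x y : D x -> D y -> D (x * y). Proof. by case: hD => _ _ _ + _; apply. Qed.
Let Dfrac x : exists a s, [/\ D a, D s, s != 0 & x = a / s].
Proof. by case: hD. Qed.

Lemma ideal_unit : is_ideal D D.
Proof.
split=> //; first by exists 1 => //; exact: oner_neq0.
by exists 1; [split=> //; exact: oner_neq0|move=> x; rewrite mul1r].
Qed.

Lemma ideal_sub_ideal I J : submod D I -> is_ideal D J -> I `<=` J ->
  (exists2 x, I x & x != 0) -> is_ideal D I.
Proof.
by move=> mI [_ _ [d dP dJ]] sIJ nzI; split=> //; exists d => // x /sIJ/dJ.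
Qed.

Lemma ideal_idealM I J : is_ideal D I -> is_ideal D J ->
  is_ideal D (idealM I J).
Proof.
move=> iI [mJ [y Jy y0] [e [De e0] eJ]].
have [mI [x Ix x0] [d [Dd d0] dI]] := iI.
split; first exact: submod_idealM.
  by exists (x * y); [exact: mem_idealM|exact: mulf_neq0].
exists (d * e); first by split; [exact: DM|exact: mulf_neq0].
have mA := submod_preim_mull (d * e) (ideal_submod ideal_unit).
move=> z Hz; apply: (idealM_sub mA _ Hz) => u v Iu Jv /=.
by rewrite mulrACA; apply: DM; [apply: dI|apply: eJ].
Qed.

Lemma ideal_colon J I : is_ideal D J -> is_ideal D I ->
  is_ideal D (colon J I).
Proof.
move=> [mJ [y Jy y0] [e [De e0] eJ]] [mI [x Ix x0] [d [Dd d0] dI]].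
split; first exact: submod_colon.
  exists (d * y); last exact: mulf_neq0.
  by move=> z Iz; rewrite mulrAC; case: mJ => _ _; apply=> //; exact: dI.
exists (e * (d * x)).
  by split; [apply: DM => //; exact: dI|rewrite !mulf_neq0].
move=> z Hz.
have -> : e * (d * x) * z = d * (e * (z * x)) by ring.
by apply: DM => //; apply: eJ; exact: Hz.
Qed.

Lemma ideal_scale a I : is_ideal D I -> a != 0 ->
  is_ideal D [set x | I (a * x)].
Proof.
move=> [mI [x Ix x0] [d [Dd d0] dI]] a0; split=> /=.
- exact: submod_preim_mull.
- exists (x / a); first by rewrite mulrC divfK.
  by rewrite mulf_neq0 ?invr_eq0.
- have [b [s [Db Ds s0 abs]]] := Dfrac a.
  have b0 : b != 0 by apply: contra_neq a0 => b0; rewrite abs b0 mul0r.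
  (* With a = b/s, a member u satisfies d a u in D, and multiplying by s turns this into d b u. *)
  exists (d * b); first by split; [exact: DM|exact: mulf_neq0].
  move=> u /dI /(DM Ds); rewrite abs.
  by have -> : s * (d * (b / s * u)) = d * b * u by field.
Qed.

(** Membership of x in I is later tested by asking whether this integral ideal of denominators is
    all of D. *)
Lemma ideal_colon_elt I x : is_ideal D I ->
  is_ideal D [set r | D r /\ I (r * x)].
Proof.
move=> [[I0 ID IM] [i Ii i0] _].
apply: (ideal_sub_ideal _ ideal_unit) => [|r []//|].
  split=> [|u v [Du Hu] [Dv Hv]|b u Db [Du Hu]] /=.
  - by rewrite mul0r.
  - by split; [exact: DD|rewrite mulrDl; exact: ID].
  - by split; [exact: DM|rewrite -mulrA; exact: IM].
(* For x = a/s and a nonzero i = b/t in I, the element s b is nonzero and s b x = a t i lies in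
   I. *)
have [a [s [Da Ds s0 xE]]] := Dfrac x.
have [b [t [Db Dt t0 iE]]] := Dfrac i.
have bE : b = t * i by rewrite iE mulrC divfK.
exists (s * b); last by rewrite bE !mulf_neq0.
split; first exact: DM.
have -> : s * b * x = a * (t * i) by rewrite xE bE; field.
by apply: (IM) => //; exact: IM.
Qed.

(* The third condition packs monotonicity, idempotence and compatibility with
   scaling into one. *)
Definition star (op : set K -> set K -> set K) : Prop :=
  [/\ forall I, is_ideal D I -> I `<=` op D I,
      forall I, is_ideal D I -> is_ideal D (op D I),
      forall I J x, is_ideal D I -> is_ideal D J ->
        (forall y, I y -> op D J (x * y)) ->
        forall y, op D I y -> op D J (x * y)
    & op D D `<=` D].

Lemma eq_star op op' :
  (forall I, is_ideal D I -> op' D I = op D I) -> star op -> star op'.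
Proof.
move=> eqop [sub id col unit]; split.
- by move=> I iI; rewrite eqop //; exact: sub.
- by move=> I iI; rewrite eqop //; exact: id.
- by move=> I J x iI iJ; rewrite !eqop //; exact: col.
- by rewrite eqop //; exact: ideal_unit.
Qed.

Lemma star_d : star d_op.
Proof. by rewrite /star /d_op; split=> [I _ x|I|I J x _ _ H y|x] //; exact: H. Qed.

Lemma v_op_sub I : I `<=` v_op D I.
Proof. by move=> x Ix y Hy; rewrite mulrC; exact: Hy. Qed.

(** For z in (D : J), the hypothesis puts x z in (D : I), and y in I^v multiplies (D : I) into D. *)
Lemma v_op_colon I J x : (forall y, I y -> v_op D J (x * y)) ->
  forall y, v_op D I y -> v_op D J (x * y).
Proof.
move=> H y Hy z Hz; rewrite [x * y]mulrC -mulrA; apply: Hy => i Ii.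
by rewrite mulrAC; exact: H.
Qed.

Lemma v_op_mono I J : I `<=` J -> v_op D I `<=` v_op D J.
Proof.
move=> sIJ y; rewrite -[y in v_op D J y]mul1r; apply: v_op_colon => z Iz.
by rewrite mul1r; exact/v_op_sub/sIJ.
Qed.

Lemma star_v : star v_op.
Proof.
split=> [I _|I iI|I J x _ _|x Hx]; [exact: v_op_sub| |exact: v_op_colon|].
  apply: ideal_colon; first exact: ideal_unit.
  by apply: ideal_colon => //; exact: ideal_unit.
by rewrite -[x]mulr1; apply: Hx => y Dy; rewrite mul1r.
Qed.

(** * Consequences of the star axioms; elementwise criteria for regularity and stability *)

Section StarTheory.
Variable op : set K -> set K -> set K.
Hypothesis hop : star op.

Lemma star_sub I : is_ideal D I -> I `<=` op D I.
Proof. by case: hop => + _ _ _; apply. Qed.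

Lemma star_ideal I : is_ideal D I -> is_ideal D (op D I).
Proof. by case: hop => _ + _ _; apply. Qed.

Lemma star_colon I J x : is_ideal D I -> is_ideal D J ->
  (forall y, I y -> op D J (x * y)) ->
  forall y, op D I y -> op D J (x * y).
Proof. by case: hop => _ _ + _; apply. Qed.

Lemma star_closed I J : is_ideal D I -> is_ideal D J ->
  I `<=` op D J -> op D I `<=` op D J.
Proof.
move=> iI iJ sIJ y; rewrite -[y in op D J y]mul1r; apply: star_colon => // z Iz.
by rewrite mul1r; exact: sIJ.
Qed.

Lemma star_mono I J : is_ideal D I -> is_ideal D J ->
  I `<=` J -> op D I `<=` op D J.
Proof. by move=> iI iJ sIJ; apply: star_closed => // x /sIJ; exact: star_sub. Qed.

Lemma star_integral I : is_ideal D I -> I `<=` D -> op D I `<=` D.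
Proof.
move=> iI sI; case: (hop) => _ _ _ unit x Hx; apply: unit.
by apply: star_mono Hx => //; exact: ideal_unit.
Qed.

Lemma star_idem I : is_ideal D I -> op D (op D I) = op D I.
Proof.
move=> iI; apply/seteqP; split; first by apply: star_closed => //; exact: star_ideal.
by apply: star_sub; exact: star_ideal.
Qed.

Lemma integral_star_ideal I : is_ideal D I -> I `<=` D ->
  is_integral_star_ideal op D (op D I).
Proof.
move=> iI sI; split; last exact: star_integral.
by split; [exact: star_ideal|rewrite star_idem].
Qed.

(** Closedness is the star axiom with multiplier x. These conductors are the t-ideals behind the
    primality of t-maximal ideals and the local nature of t. *)
Lemma colon_elt_star I x : is_ideal D I ->
  is_integral_star_ideal op D [set r | D r /\ op D I (r * x)].
Proof.
move=> iI; have iA := ideal_colon_elt x (star_ideal iI).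
have sA : [set r | D r /\ op D I (r * x)] `<=` D by move=> r [].
split=> //; split=> //; apply/seteqP; split; first exact: star_sub.
move=> r Hr; split; first exact: (star_integral iA sA).
rewrite mulrC; apply: star_colon Hr => // y [_].
by rewrite mulrC.
Qed.

(** Any witness J of regularity lies in Q = (I^* : I^2), and (I^2 Q)^* is always inside I^*, so Q is
    the best candidate. *)
Lemma star_regularP I : is_ideal D I ->
  star_regular op D I <->
  I `<=` op D (idealM (idealM I I) (colon (op D I) (idealM I I))).
Proof.
move=> iI; have iII := ideal_idealM iI iI.
have iQ := ideal_colon (star_ideal iI) iII.
have iIIQ := ideal_idealM iII iQ.
split=> [[J iJ IE] x Ix|sI].
  have : op D I x by exact: star_sub.
  have iIIJ := ideal_idealM iII iJ.
  rewrite {1}IE; apply: star_mono => //; apply: idealM_mono => // j Jj z Hz.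
  by rewrite IE mulrC; apply: star_sub => //; exact: mem_idealM.
exists (colon (op D I) (idealM I I)) => //; apply/seteqP; split.
  exact: star_closed.
apply: star_closed => //; apply: idealM_sub (ideal_submod (star_ideal iI)) _.
by move=> x y Hx Hy; rewrite mulrC; exact: Hy.
Qed.

(** Write A = I^* and E = (A : A). Then (E : A) equals Q = (A : I^2), since the star axiom replaces
    each factor I by A. Moreover (A Q)^* is an ideal of E equal to (I Q)^*, so it is E exactly when
    it contains 1. *)
Lemma star_stableP I : is_ideal D I ->
  star_stable_ideal op D I <->
  op D (idealM I (colon (op D I) (idealM I I))) 1.
Proof.
move=> iI; rewrite /star_stable_ideal /=.
set A := op D I; set E := endo A; set Q := colon A _; set P := colon E A.
have iA : is_ideal D A by exact: star_ideal.
have iII := ideal_idealM iI iI.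
have iQ : is_ideal D Q by exact: ideal_colon.
have iE : is_ideal D E by exact: ideal_colon.
have PE : P = Q.
  apply/seteqP; split=> x Hx.
    move=> z Hz; rewrite mulrC; move: z Hz.
    apply: (idealM_sub (submod_preim_mul x (ideal_submod iA))) => u v Iu Iv /=.
    by rewrite mulrC mulrA; apply: Hx; apply: star_sub.
  move=> a Aa b Ab; rewrite mulrAC; apply: star_colon Aa => // i Ii.
  rewrite mulrAC; apply: star_colon Ab => // j Ij.
  by rewrite -mulrA; apply/Hx/mem_idealM.
rewrite PE; have iIQ := ideal_idealM iI iQ; have iAQ := ideal_idealM iA iQ.
split=> [AQE|IQ1].
  have : op D (idealM A Q) 1 by rewrite AQE => a Aa; rewrite mul1r.
  apply: star_closed => //; apply: idealM_sub (ideal_submod (star_ideal iIQ)) _.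
  move=> a q Aa Qq; rewrite mulrC; apply: star_colon Aa => // i Ii.
  by rewrite mulrC; apply: star_sub => //; exact: mem_idealM.
have AQ_E : idealM A Q `<=` E.
  apply: idealM_sub (ideal_submod iE) _ => a q Aa; rewrite -PE => Pq.
  by rewrite mulrC; exact: Pq.
apply/seteqP; split=> e He.
  move=> a Aa; rewrite mulrC; apply: star_colon He => // z /AQ_E Ez.
  by rewrite mulrC; exact: Ez.
(* Multiplication by e sends I Q into A Q, because e I is inside A; hence e lies in (A Q)^*. *)
rewrite -[e]mulr1; apply: star_colon IQ1 => //.
move=> z Hz; apply: star_sub => //; rewrite mulrC.
move: z Hz.
apply: (idealM_sub (submod_preim_mul e (ideal_submod iAQ))) => i q Ii Qq /=.
by rewrite mulrAC; apply: mem_idealM => //; rewrite mulrC; apply/He/star_sub.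
Qed.

End StarTheory.

End FractionalIdeals.

(** * Localization at a prime and extension of ideals *)

Section Localization.
Variable K : fieldType.
Variable D : set K.
Hypothesis hD : subring_with_fractions D.
Implicit Types (I J A B X : set K) (x y s : K).

(** Together with 1 in D, this makes the complement of [M] in [D] a multiplicative set avoiding 0,
    which is what fractions in [loc D M] require. *)
Definition prime_in (M : set K) : Prop :=
  [/\ M 0, ~ M 1 & forall s t, D s -> D t -> M (s * t) -> M s \/ M t].

Variable M : set K.
Hypothesis hM : prime_in M.

Local Notation L := (loc D M).
Local Notation ext I := (idealM I (loc D M)).

Let D0 : D 0. Proof. by case: hD. Qed.
Let D1 : D 1. Proof. by case: hD. Qed.
Let DD x y : D x -> D y -> D (x + y). Proof. by case: hD => _ _ + _ _; apply. Qed.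
Let DM x y : D x -> D y -> D (x * y). Proof. by case: hD => _ _ _ + _; apply. Qed.
Let Dfrac x : exists a s, [/\ D a, D s, s != 0 & x = a / s].
Proof. by case: hD. Qed.

Let M1 : ~ M 1. Proof. by case: hM. Qed.

Let MM s t : D s -> D t -> ~ M s -> ~ M t -> ~ M (s * t).
Proof.
move=> Ds Dt nMs nMt Mst; case: hM => _ _ /(_ _ _ Ds Dt Mst).
by case.
Qed.

Let M_neq0 s : ~ M s -> s != 0.
Proof. by move=> nMs; apply/eqP => s0; apply: nMs; rewrite s0; case: hM. Qed.

Lemma sub_loc : D `<=` L.
Proof. by move=> a Da; exists a, 1; split=> //; rewrite divr1. Qed.

Lemma loc_inv s : D s -> ~ M s -> L s^-1.
Proof. by move=> Ds nMs; exists 1, s; split=> //; rewrite div1r. Qed.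

Lemma loc_fractions : subring_with_fractions L.
Proof.
split; [exact: sub_loc|exact: sub_loc| | |].
- move=> _ _ [a [s [Da Ds nMs ->]]] [b [t [Db Dt nMt ->]]].
  exists (a * t + b * s), (s * t); split; [|exact: DM|exact: MM|].
    by apply: DD; exact: DM.
  by rewrite addf_div ?M_neq0.
- move=> _ _ [a [s [Da Ds nMs ->]]] [b [t [Db Dt nMt ->]]].
  exists (a * b), (s * t); split; [exact: DM|exact: DM|exact: MM|].
  by rewrite mulf_div.
- move=> x; have [a [s [Da Ds s0 ->]]] := Dfrac x.
  by exists a, s; split=> //; exact: sub_loc.
Qed.

Lemma submod_loc X : submod L X -> submod D X.
Proof. by case=> X0 XD XM; split=> // a x /sub_loc; exact: XM. Qed.

Lemma sub_ext I : I `<=` ext I.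
Proof.
by move=> x Ix; rewrite -[x]mulr1; apply: mem_idealM => //; exact: sub_loc.
Qed.

(** Single fractions are closed under sums, by bringing them to a common denominator. *)
Lemma extP I x : submod D I ->
  ext I x <-> exists i s, [/\ I i, D s, ~ M s & x = i / s].
Proof.
move=> [I0 ID IM]; split; last first.
  by move=> [i [s [Ii Ds nMs ->]]]; apply: mem_idealM => //; exact: loc_inv.
pose A := [set x | exists i s, [/\ I i, D s, ~ M s & x = i / s]].
have mA : submod D A.
  split=> [|_ _ [i [s [Ii Ds nMs ->]]] [j [t [Ij Dt nMt ->]]]|
           a _ Da [i [s [Ii Ds nMs ->]]]].
  - by exists 0, 1; split=> //; rewrite mul0r.
  - exists (t * i + s * j), (s * t); split; [|exact: DM|exact: MM|].
      by apply: ID; exact: IM.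
    by rewrite addf_div ?M_neq0 // [i * t]mulrC [j * s]mulrC.
  - by exists (a * i), s; split=> //; [exact: IM|rewrite mulrA].
apply: (idealM_sub mA) => i _ Ii [a [s [Da Ds nMs ->]]].
by exists (a * i), s; split=> //; [exact: IM|rewrite mulrA [i * a]mulrC].
Qed.

Lemma mem_ext I i s : I i -> D s -> ~ M s -> ext I (i / s).
Proof. by move=> Ii Ds nMs; apply: mem_idealM => //; exact: loc_inv. Qed.

Lemma submod_ext I : submod D I -> submod L (ext I).
Proof.
move=> mI; have [I0 ID IM] := mI.
split=> [|x y|_ x [a [s [Da Ds nMs ->]]]].
- exact: sub_ext.
- exact: idealM_add.
- move=> /(extP _ mI) [i [t [Ii Dt nMt ->]]].
  by rewrite mulf_div; apply: mem_ext; [exact: IM|exact: DM|exact: MM].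
Qed.

Lemma ext_sub I X : submod L X -> I `<=` X -> ext I `<=` X.
Proof.
move=> mX sIX; apply: (idealM_sub (submod_loc mX)) => x y /sIX Xx Ly.
by rewrite mulrC; case: mX => _ _; apply.
Qed.

Lemma ideal_ext I : is_ideal D I -> is_ideal L (ext I).
Proof.
move=> [mI [x Ix x0] [d [Dd d0] dI]]; split; first exact: submod_ext.
  by exists x => //; exact: sub_ext.
exists d; first by split=> //; exact: sub_loc.
move=> y /(extP _ mI) [i [s [Ii Ds nMs ->]]].
by exists (d * i), s; split=> //; [exact: dI|rewrite mulrA].
Qed.

(** It reduces statements about all ideals of D_M to extended ones. The ideal X is cut down to its
    elements with one fixed denominator in D, and everything else is reached by dividing by elements
    outside M. *)
Lemma ideal_loc_extended X : is_ideal L X ->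
  exists2 I, is_ideal D I & X = ext I.
Proof.
move=> [mX [x Xx x0] [d [Ld d0] dX]]; have [X0 XD XM] := mX.
have [a [s [Da Ds nMs dE]]] := Ld.
have a0 : a != 0 by apply: contra_neq d0 => a0; rewrite dE a0 mul0r.
(* Since d y = b/t and d = a/s, the element t clears the denominator of a y. *)
have den y : X y -> exists t, [/\ D t, ~ M t & D (a * (t * y))].
  move=> /dX [b [t [Db Dt nMt /(congr1 (fun z => s * t * z))]]].
  rewrite dE => E; exists t; split=> //.
  have -> : a * (t * y) = s * t * (a / s * y) by field; exact: M_neq0.
  rewrite E; have -> : s * t * (b / t) = s * b by field; exact: M_neq0.
  exact: DM.
pose I := [set y | X y /\ D (a * y)].
have mI : submod D I.
  split=> [|u v [Xu Du] [Xv Dv]|b u Db [Xu Du]] /=.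
  - by rewrite /I /= mulr0.
  - by split; [exact: XD|rewrite mulrDr; exact: DD].
  - by split; [apply: XM => //; exact: sub_loc|rewrite mulrCA; exact: DM].
have denX y : X y -> exists t, [/\ D t, ~ M t & I (t * y)].
  move=> Xy; have [t [Dt nMt Dat]] := den _ Xy; exists t; split=> //.
  by split=> //; apply: XM => //; exact: sub_loc.
exists I.
  split=> //; last by exists a => // y [].
  have [t [Dt nMt It]] := denX _ Xx.
  by exists (t * x) => //; apply: mulf_neq0 => //; exact: M_neq0.
apply/seteqP; split; last by apply: ext_sub => // y [].
move=> y /denX [t [Dt nMt It]].
have -> : y = t * y / t by field; exact: M_neq0.
exact: mem_ext.
Qed.

Lemma ext_idealM I J : submod D I -> submod D J ->
  idealM (ext I) (ext J) = ext (idealM I J).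
Proof.
move=> mI mJ; have mIJ := submod_idealM J mI.
apply/seteqP; split.
  apply: (idealM_sub (submod_loc (submod_ext mIJ))) => x y.
  move=> /(extP _ mI) [i [s [Ii Ds nMs ->]]] /(extP _ mJ) [j [t [Jj Dt nMt ->]]].
  by rewrite mulf_div; apply: mem_ext; [exact: mem_idealM|exact: DM|exact: MM].
apply: ext_sub; first exact/submod_idealM/submod_ext.
by apply: idealM_mono; exact: sub_ext.
Qed.

Lemma common_denominator A (T : finType) (f : T -> K) : submod D A ->
  (forall i, ext A (f i)) ->
  exists s, [/\ D s, ~ M s & forall i, A (s * f i)].
Proof.
move=> mA Af; have [_ _ AM] := mA.
have /choice[g gP] : forall i, exists s, [/\ D s, ~ M s & A (s * f i)].
  move=> i; have /(extP _ mA) [a [s [Aa Ds nMs ->]]] := Af i.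
  by exists s; rewrite mulrC divfK ?M_neq0.
have prodP (P : pred T) : D (\prod_(i | P i) g i) /\ ~ M (\prod_(i | P i) g i).
  elim/big_rec: _ => // i s _ [Ds nMs]; have [Dg nMg _] := gP i.
  by split; [exact: DM|exact: MM].
exists (\prod_i g i); split; [by case: (prodP predT)|by case: (prodP predT)|].
move=> i; rewrite (bigD1 i) //= mulrAC mulrC; apply: AM.
  exact: (prodP _).1.
by case: (gP i).
Qed.

(** Finite generation enters here: a common denominator for the products of x with the generators
    serves the whole span, the conclusion being linear in y. *)
Lemma fg_denominator A n (g : 'I_n -> K) x : submod D A ->
  (forall y, span D g y -> ext A (x * y)) ->
  exists s, [/\ D s, ~ M s & forall y, span D g y -> A (s * x * y)].
Proof.
move=> mA gA; have [|s [Ds nMs sA]] := @common_denominator A _ (fun i => x * g i) mA.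
  by move=> i; apply: gA; exact: mem_span.
exists s; split=> //.
apply: (span_sub (submod_preim_mull (s * x) mA)) => i /=.
by rewrite -mulrA.
Qed.

Lemma ext_span n (g : 'I_n -> K) : ext (span D g) = span L g.
Proof.
apply/seteqP; split.
  apply: ext_sub; first exact/submod_span/loc_fractions.
  by move=> x [c Dc ->]; exists c => // i; exact: sub_loc.
apply: span_sub; first exact/submod_ext/submod_span.
by move=> i; apply/sub_ext/mem_span.
Qed.

End Localization.

(** * Transfer between a star operation [op] of D and operations [op'] of its localizations *)

Section LocalGlobal.
Variable K : fieldType.
Variable D : set K.
Hypothesis hD : subring_with_fractions D.
Variable T : set (set K).
Hypothesis hT : forall M, T M -> prime_in D M.
Variables op op' : set K -> set K -> set K.
Hypothesis hop : star D op.
Hypothesis hop' : forall M, T M -> star (loc D M) op'.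
Hypothesis op_ext : forall M I, T M -> is_ideal D I ->
  op' (loc D M) (idealM I (loc D M)) = idealM (op D I) (loc D M).
Hypothesis op_local : forall I x, is_ideal D I ->
  (forall M, T M -> idealM (op D I) (loc D M) x) -> op D I x.
Implicit Types (I J M : set K) (x y s : K).

(** The nontrivial inclusion in (I^* : I^2) D_M = (I^* D_M : I^2 D_M), isolated because its proof
    depends on the operation and on the domain. *)
Definition colon_localizes I M : Prop :=
  forall y, (forall z, idealM I I z -> idealM (op D I) (loc D M) (y * z)) ->
  exists s, [/\ D s, ~ M s & forall z, idealM I I z -> op D I (s * y * z)].

Local Notation ext M I := (idealM I (loc D M)).
Local Notation Q I := (colon (op D I) (idealM I I)).
Local Notation Q' M I :=
  (colon (op' (loc D M) (ext M I)) (idealM (ext M I) (ext M I))).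

Let iII I : is_ideal D I -> is_ideal D (idealM I I).
Proof. by move=> iI; exact: ideal_idealM. Qed.

Let iQ I : is_ideal D I -> is_ideal D (Q I).
Proof.
by move=> iI; apply: ideal_colon => //; [exact: star_ideal|exact: iII].
Qed.

Let mopI I : is_ideal D I -> submod D (op D I).
Proof. by move=> iI; apply: ideal_submod; exact: star_ideal. Qed.

Lemma colon_extE M I : T M -> is_ideal D I ->
  Q' M I = colon (ext M (op D I)) (ext M (idealM I I)).
Proof.
move=> TM iI; have hM := hT TM; have mI := ideal_submod iI.
by rewrite op_ext // ext_idealM.
Qed.

Lemma ext_colon_sub M I : T M -> is_ideal D I -> ext M (Q I) `<=` Q' M I.
Proof.
move=> TM iI; have hM := hT TM; rewrite colon_extE //.
have mo := submod_ext hD hM (mopI iI).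
apply: ext_sub => //; first exact: submod_colon.
move=> q Qq z; rewrite mulrC; move: z.
apply: ext_sub => //; first exact: submod_preim_mul.
by move=> z Hz /=; rewrite mulrC; apply: sub_ext => //; exact: Qq.
Qed.

Lemma colon_sub_ext M I : T M -> is_ideal D I -> colon_localizes I M ->
  Q' M I `<=` ext M (Q I).
Proof.
move=> TM iI cl y; have hM := hT TM; rewrite colon_extE // => Hy.
have [|s [Ds nMs sQ]] := cl y; first by move=> z Hz; apply: Hy; exact: sub_ext.
have s0 : s != 0 by apply/eqP => s0; apply: nMs; rewrite s0; case: hM.
have -> : y = s * y / s by rewrite mulrC mulKf.
exact: mem_ext.
Qed.

(** Extension commutes with products and with the star operation, so a witness for I extends to a
    witness for I D_M. *)
Lemma regular_localizes : clifford_regular op D ->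
  forall M, T M -> clifford_regular op' (loc D M).
Proof.
move=> reg M TM X iX; have hM := hT TM.
have [I iI ->] := ideal_loc_extended hD hM iX.
have mI := ideal_submod iI.
have [J iJ IE] := reg _ iI.
exists (ext M J); first exact: ideal_ext.
rewrite ext_idealM // ext_idealM //; last first.
- exact: ideal_submod.
- exact: submod_idealM.
by rewrite !op_ext ?IE //; apply: ideal_idealM => //; exact: iII.
Qed.

(** The relation 1 in (I Q)^* extends to D_M, where Q D_M sits inside the local colon; only this
    easy inclusion is used. *)
Lemma stable_localizes : star_stable op D ->
  forall M, T M -> star_stable op' (loc D M).
Proof.
move=> stab M TM X iX; have hM := hT TM; have hL := loc_fractions hD hM.
have [I iI XE] := ideal_loc_extended hD hM iX.
apply/(star_stableP hL (hop' TM) iX); rewrite XE.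
have /(star_stableP hD hop iI) /(sub_ext hD hM) := stab _ iI.
have iIQ := ideal_idealM hD iI (iQ iI).
rewrite -op_ext // -(ext_idealM hD hM) //; last 2 first.
- exact: ideal_submod.
- exact/ideal_submod/iQ.
have iX' : is_ideal (loc D M) (ext M I) by exact: ideal_ext.
apply: (star_mono (hop' TM)).
- by apply: ideal_idealM => //; exact/ideal_ext/iQ.
- apply: ideal_idealM => //; apply: ideal_colon => //.
    exact: (star_ideal (hop' TM)).
  exact: ideal_idealM.
- by apply: idealM_mono => //; exact: ext_colon_sub.
Qed.

(** Each x in I is tested for membership in (I^2 Q)^* at every M, where Q D_M is now the local
    colon. *)
Lemma regular_of_local :
  (forall M I, T M -> is_ideal D I -> colon_localizes I M) ->
  (forall M, T M -> clifford_regular op' (loc D M)) -> clifford_regular op D.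
Proof.
move=> cl reg I iI; apply/(star_regularP hD hop iI) => x Ix.
have iIIQ := ideal_idealM hD (iII iI) (iQ iI).
apply: op_local => // M TM; have hM := hT TM; have hL := loc_fractions hD hM.
have iX := ideal_ext hD hM iI.
have /(star_regularP hL (hop' TM) iX) /(_ x) := reg M TM _ iX.
move=> /(_ (sub_ext hD hM Ix)).
have QE : Q' M I = ext M (Q I).
  apply/seteqP; split; last exact: ext_colon_sub.
  by apply: colon_sub_ext => //; exact: cl.
have mI := ideal_submod iI; have mII := ideal_submod (iII iI).
have mQ := ideal_submod (iQ iI).
by rewrite QE !ext_idealM // op_ext.
Qed.

Lemma stable_of_local :
  (forall M I, T M -> is_ideal D I -> colon_localizes I M) ->
  (forall M, T M -> star_stable op' (loc D M)) -> star_stable op D.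
Proof.
move=> cl stab I iI; apply/(star_stableP hD hop iI).
have iIQ := ideal_idealM hD iI (iQ iI).
apply: op_local => // M TM; have hM := hT TM; have hL := loc_fractions hD hM.
have iX := ideal_ext hD hM iI.
have /(star_stableP hL (hop' TM) iX) := stab M TM _ iX.
have QE : Q' M I = ext M (Q I).
  apply/seteqP; split; last exact: ext_colon_sub.
  by apply: colon_sub_ext => //; exact: cl.
rewrite QE ext_idealM //; last 2 first.
- exact: ideal_submod.
- exact/ideal_submod/iQ.
by rewrite op_ext.
Qed.

(* If I^2 has the same op-closure as a finitely generated J, one denominator
   clears the finitely many generators of J. *)
Lemma finite_type_colon_localizes M I J : T M -> is_ideal D I ->
  is_fg_ideal D J -> J `<=` idealM I I -> idealM I I `<=` op D J ->
  colon_localizes I M.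
Proof.
move=> TM iI [iJ [n [g JE]]] sJ sI y Hy.
have hM := hT TM.
have [z Jz|s [Ds nMs sA]] := @fg_denominator _ _ hD _ hM (op D I) n g y (mopI iI).
  by apply/Hy/sJ; rewrite JE.
exists s; split=> // z /sI; apply: (star_colon hop) => // w.
by rewrite JE; exact: sA.
Qed.

End LocalGlobal.

(** * Chain conditions and ideals of finite type *)

Section ChainCondition.
Variable K : fieldType.
Implicit Types (P : set K -> Prop) (A D I J M : set K).

Lemma acc_sub P P' : (forall I, P' I -> P I) -> acc P -> acc P'.
Proof. by move=> sP aP I PI; apply: aP => n; exact: sP. Qed.

Lemma acc_maximal P A : acc P -> P A ->
  exists M, [/\ P M, A `<=` M & forall J, P J -> M `<=` J -> J = M].
Proof.
move=> aP PA; apply: contrapT => noM.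
(* Without a maximal element, [f] strictly enlarges each member of [P] above [A]; its iterates from
   [A] violate the chain condition. *)
have /choice[f fP] : forall I, exists J, P I /\ A `<=` I ->
    [/\ P J, I `<=` J & J <> I].
  move=> I; have [[PI AI]|] := pselect (P I /\ A `<=` I); last by exists I.
  apply: contrapT => noJ; apply: noM; exists I; split=> // J PJ IJ.
  by apply: contrapT => JI; apply: noJ; exists J.
pose I n := iter n f A.
have PI n : P (I n) /\ A `<=` I n.
  elim: n => [|n [PIn AIn]] /=; first by split.
  have [//|PJ IJ _] := fP (I n).
  by split=> // x /AIn/IJ.
have sI n : I n `<=` I n.+1 by have [//|_ + _] := fP (I n).
have [N /(_ N.+1 (leqnSn N))] := aP I (fun n => (PI n).1) sI.
by have [//|_ _] := fP (I N).
Qed.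

Section FiniteType.
Variables (D : set K) (op : set K -> set K -> set K).
Hypothesis hD : subring_with_fractions D.
Hypothesis hop : star D op.
Hypothesis aop : acc (is_integral_star_ideal op D).

Let seqspan (s : seq K) := span D (fun i : 'I_(size s) => s`_i).

Let mem_seqspan (s : seq K) x : x \in s -> seqspan s x.
Proof.
move=> sx; rewrite -(nth_index 0 sx).
have Hi : (index x s < size s)%N by rewrite index_mem.
exact: (mem_span (fun i : 'I_(size s) => s`_i) (Ordinal Hi) hD).
Qed.

Let seqspan_sub (s : seq K) A : submod D A -> (forall x, x \in s -> A x) ->
  seqspan s `<=` A.
Proof. by move=> mA sA; apply: span_sub => // i; apply/sA/mem_nth. Qed.

Let seqspan_fg (s : seq K) x I : is_ideal D I -> (forall x, x \in s -> I x) ->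
  x \in s -> x != 0 -> is_fg_ideal D (seqspan s).
Proof.
move=> iI sI sx x0; split; last by exists (size s), (fun i => s`_i).
apply: (ideal_sub_ideal _ iI); first exact: submod_span.
  by apply: seqspan_sub => //; exact: ideal_submod.
by exists x => //; exact: mem_seqspan.
Qed.

(** Otherwise the closure of every finitely generated subideal misses an element of I, and adjoining
    such elements one at a time gives a strictly ascending chain of integral star ideals. *)
Lemma finite_type_of_acc_integral I : is_ideal D I -> I `<=` D ->
  exists J, [/\ is_fg_ideal D J, J `<=` I & I `<=` op D J].
Proof.
move=> iI sID; have mI := ideal_submod iI; apply: contrapT => noJ.
have [_ [x0 Ix0 x0_neq0] _] := iI.
(* Keeping the nonzero x0 in every list makes each span a nonzero ideal. *)
pose good (s : seq K) := (forall x, x \in s -> I x) /\ x0 \in s.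
have fg s : good s -> is_fg_ideal D (seqspan s).
  by move=> [sI sx0]; exact: (seqspan_fg iI sI sx0).
have /choice[f fP] : forall s, exists x, good s -> I x /\ ~ op D (seqspan s) x.
  move=> s; have [gs|] := pselect (good s); last by exists 0.
  apply: contrapT => nox; apply: noJ; exists (seqspan s); split.
  - exact: fg.
  - by apply: seqspan_sub => //; case: gs.
  - by move=> x Ix; apply: contrapT => nx; apply: nox; exists x.
pose s n := iter n (fun s => f s :: s) [:: x0].
have gs n : good (s n).
  elim: n => [|n gn] /=.
    by split=> [x|]; rewrite inE // => /eqP ->.
  have [If _] := fP _ gn; case: gn => sI sx0.
  split=> [x|]; rewrite inE; last by rewrite sx0 orbT.
  by move=> /orP[/eqP ->|/sI].
have iJ n : is_ideal D (seqspan (s n)) by case: (fg _ (gs n)).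
have sJ n x : x \in s n -> seqspan (s n.+1) x.
  by move=> sx; apply: mem_seqspan; rewrite inE sx orbT.
have [n|n|N /(_ N.+1 (leqnSn N)) E] := aop (I := fun n => op D (seqspan (s n))).
- apply: integral_star_ideal => //.
  by move=> x Hx; apply/sID; move: x Hx; apply: seqspan_sub => //; case: (gs n).
- apply: (star_mono hop) => //; apply: seqspan_sub; last exact: sJ.
  exact: ideal_submod.
- have [_] := fP _ (gs N); rewrite -E; apply.
  by apply: (star_sub hop) => //; apply: mem_seqspan; rewrite inE eqxx.
Qed.

(** The integral case is applied to d I, with d a denominator of I, and the resulting subideal is
    scaled back by d^-1. *)
Lemma finite_type_of_acc I : is_ideal D I ->
  exists J, [/\ is_fg_ideal D J, J `<=` I & I `<=` op D J].
Proof.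
move=> iI; have [_ _ [d [Dd d0] dI]] := iI.
have dV0 : d^-1 != 0 by rewrite invr_eq0.
have [|x /=|J [[iJ [n [g JE]]] sJI sIJ]] :=
  @finite_type_of_acc_integral [set x | D x /\ I (d^-1 * x)].
- have := ideal_colon_elt hD d^-1 iI.
  by congr is_ideal; apply/seteqP; split=> x []; rewrite mulrC.
- by case.
have iJ' : is_ideal D [set x | J (d * x)] by exact: ideal_scale.
have J'E : [set x | J (d * x)] = span D (fun i => d^-1 * g i).
  rewrite JE; apply/seteqP; split=> x /=.
    move=> [c Dc E]; exists c => //; rewrite -[x](mulKf d0) E mulr_sumr.
    by apply: eq_bigr => i _; rewrite mulrCA.
  move=> [c Dc ->]; exists c => //; rewrite mulr_sumr.
  by apply: eq_bigr => i _; rewrite mulrCA mulVKf.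
exists [set x | J (d * x)]; split.
- by split=> //; exists n, (fun i => d^-1 * g i).
- by move=> x /sJI [_]; rewrite mulKf.
- move=> x Ix; rewrite -[x](mulKf d0); apply: (star_colon hop iJ iJ').
    by move=> y Jy; apply: (star_sub hop) => //=; rewrite mulVKf.
  by apply: sIJ; split; [exact: dI|rewrite mulKf].
Qed.

End FiniteType.

End ChainCondition.

(** * The t-operation over a Mori domain and over its localizations *)

Lemma t_op_eq_v (K : fieldType) (D I : set K) : is_ideal D I ->
  (exists J, [/\ is_fg_ideal D J, J `<=` I & I `<=` v_op D J]) ->
  t_op D I = v_op D I.
Proof.
move=> iI [J [fgJ sJI sIJ]]; apply/seteqP; split.
  by move=> x [J' [_ sJ'] vx]; exact: (v_op_mono sJ').
move=> x vx; exists J => //; rewrite -[x]mul1r; apply: v_op_colon vx => y /sIJ.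
by rewrite mul1r.
Qed.

Section Mori.
Variable K : fieldType.
Variable D : set K.
Hypothesis hD : subring_with_fractions D.
Hypothesis D_mori : mori D.
Implicit Types (I J M N : set K) (x y s d : K).

Local Notation ext M I := (idealM I (loc D M)).

Lemma v_finite_type I : is_ideal D I ->
  exists J, [/\ is_fg_ideal D J, J `<=` I & I `<=` v_op D J].
Proof. exact: (finite_type_of_acc hD (star_v hD)). Qed.

Lemma mori_t_eq_v I : is_ideal D I -> t_op D I = v_op D I.
Proof. by move=> iI; apply: t_op_eq_v => //; exact: v_finite_type. Qed.

Lemma star_t : star D t_op.
Proof. exact: (eq_star hD mori_t_eq_v (star_v hD)). Qed.

Lemma t_finite_type I : is_ideal D I ->
  exists J, [/\ is_fg_ideal D J, J `<=` I & I `<=` t_op D J].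
Proof.
move=> /v_finite_type[J [fgJ sJI sIJ]]; exists J; split=> //.
by rewrite mori_t_eq_v //; case: fgJ.
Qed.

(** The chain condition takes the place of Zorn's lemma. *)
Lemma t_Max_above I : is_proper_integral_t_ideal D I ->
  exists2 M, t_Max D M & I `<=` M.
Proof.
have aP : acc (is_proper_integral_t_ideal D).
  apply: acc_sub D_mori => J [[[iJ JE] sJ] _].
  by split=> //; split=> //; rewrite -mori_t_eq_v.
by move=> /(acc_maximal aP)[M [PM sIM maxM]]; exists M.
Qed.

Lemma t_Max_ideal M : t_Max D M -> is_ideal D M.
Proof. by move=> [[[[]]]]. Qed.

Lemma t_Max_closed M : t_Max D M -> t_op D M = M.
Proof. by move=> [[[[_ <-]]]]. Qed.

(** If a b lies in M, the conductor of b into M is an integral t-ideal containing M and a. By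
    maximality it is D, so that b is in M, or it is M, so that a is in M. *)
Lemma t_Max_prime M : t_Max D M -> prime_in D M.
Proof.
move=> tM; have iM := t_Max_ideal tM; have [M0 MD MM] := ideal_submod iM.
have [[[[_ ME] sM] nM] maxM] := tM.
have [_ D1 _ _ _] := hD; split=> //.
  move=> M1; apply: nM; apply/seteqP; split=> // x Dx.
  by rewrite -[x]mulr1; exact: MM.
move=> a b Da Db Mab; have := colon_elt_star hD star_t b iM.
rewrite -ME; set C := [set r | _] => tC.
have [CD|nCD] := pselect (C = D).
  right; have [_] : C 1 by rewrite CD.
  by rewrite mul1r.
have CM : C = M.
  apply: maxM; first by split.
  by move=> r Mr; split; [exact: sM|rewrite mulrC; exact: MM].
by left; rewrite -CM; split.
Qed.

(** If x is outside I^t, its conductor into I^t is a proper t-ideal, hence lies in some t-maximal M;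
    but membership at M gives a denominator of x outside M. *)
Lemma t_op_local I x : is_ideal D I ->
  (forall M, t_Max D M -> ext M (t_op D I) x) -> t_op D I x.
Proof.
move=> iI Hx; have [_ D1 _ _ _] := hD.
have tC := colon_elt_star hD star_t x iI.
move: tC; set C := [set r | _] => tC.
have [CD|nCD] := pselect (C = D).
  have [_] : C 1 by rewrite CD.
  by rewrite mul1r.
have [|M tM sCM] := @t_Max_above C; first by split.
have hM := t_Max_prime tM.
have /(extP hD hM _ (ideal_submod (star_ideal star_t iI))) := Hx _ tM.
move=> [i [s [Ii Ds nMs xE]]].
have s0 : s != 0 by apply/eqP => s0; apply: nMs; rewrite s0; case: hM.
by case: nMs; apply: sCM; split=> //; rewrite xE mulrC divfK.
Qed.

Lemma colon_ext M I : t_Max D M -> is_ideal D I ->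
  colon (loc D M) (ext M I) = ext M (colon D I).
Proof.
move=> tM iI; have hM := t_Max_prime tM; have iD := ideal_unit hD.
have mC := submod_colon I (ideal_submod iD).
have hL := loc_fractions hD hM; have mL := ideal_submod (ideal_unit hL).
apply/seteqP; split=> x.
  have [J [[iJ [n [g JE]]] sJI sIJ]] := v_finite_type iI.
  move=> Hx; have [z|s [Ds nMs sxJ]] :=
    @fg_denominator _ _ hD _ hM D n g x (ideal_submod iD).
    rewrite -JE => /sJI Iz; have [a [s [Da Ds nMs ->]]] := Hx _ (sub_ext hD hM Iz).
    exact: mem_ext.
  have s0 : s != 0 by apply/eqP => s0; apply: nMs; rewrite s0; case: hM.
  have -> : x = s * x / s by rewrite mulrC mulKf.
  (* The element s x lies in (D : J), and I is inside J^v, so s x I is inside D. *)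
  apply: mem_ext => // y Iy; rewrite mulrC; apply: (sIJ y Iy) => z Jz.
  by apply: sxJ; rewrite -JE.
move: x; apply: ext_sub => //; first exact: submod_colon.
move=> x Hx z; rewrite mulrC; move: z; apply: ext_sub => //.
  exact: submod_preim_mul.
by move=> z Iz /=; rewrite mulrC; apply: sub_loc => //; exact: Hx.
Qed.

Lemma v_op_ext M I : t_Max D M -> is_ideal D I ->
  v_op (loc D M) (ext M I) = ext M (v_op D I).
Proof.
move=> tM iI; rewrite /v_op !colon_ext //.
by apply: ideal_colon => //; exact: ideal_unit.
Qed.

(** Write X = I D_M: a finitely generated J with I inside J^v extends to one for X, since v commutes
    with the extension. *)
Lemma loc_t_eq_v M X : t_Max D M -> is_ideal (loc D M) X ->
  t_op (loc D M) X = v_op (loc D M) X.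
Proof.
move=> tM iX; have hM := t_Max_prime tM; apply: t_op_eq_v => //.
have [I iI ->] := ideal_loc_extended hD hM iX.
have [J [[iJ [n [g JE]]] sJI sIJ]] := v_finite_type iI.
exists (ext M J); split.
- split; first exact: ideal_ext.
  by exists n, g; rewrite JE ext_span.
- exact: idealM_mono.
- by rewrite v_op_ext //; exact: idealM_mono.
Qed.

Lemma star_t_loc M : t_Max D M -> star (loc D M) t_op.
Proof.
move=> tM; have hL := loc_fractions hD (t_Max_prime tM).
by apply: (eq_star hL) (star_v hL) => X; exact: loc_t_eq_v.
Qed.

Lemma t_op_ext M I : t_Max D M -> is_ideal D I ->
  t_op (loc D M) (ext M I) = ext M (t_op D I).
Proof.
move=> tM iI; rewrite mori_t_eq_v // -v_op_ext //; apply: loc_t_eq_v => //.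
exact: (ideal_ext hD (t_Max_prime tM)).
Qed.

(** * The w-operation, finite character and w-stability over a Mori domain *)

Lemma sub_w_op I : I `<=` w_op D I.
Proof. by move=> x Ix M tM; apply: (sub_ext hD (t_Max_prime tM)). Qed.

Lemma w_op_ext M I : t_Max D M -> is_ideal D I -> ext M (w_op D I) = ext M I.
Proof.
move=> tM iI; have hM := t_Max_prime tM; apply/seteqP; split.
  apply: ext_sub => //; first exact/submod_ext/ideal_submod.
  by move=> x; exact.
by apply: idealM_mono => //; exact: sub_w_op.
Qed.

Lemma w_op_sub_t I : is_ideal D I -> w_op D I `<=` t_op D I.
Proof.
move=> iI x wx; apply: t_op_local => // M tM.
by have := wx M tM; apply: idealM_mono => //; exact: (star_sub star_t).
Qed.

Lemma star_w : star D w_op.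
Proof.
split.
- by move=> I _; exact: sub_w_op.
(* I^w is fractional because it lies inside the fractional ideal I^t. *)
- move=> I iI; have it := star_ideal star_t iI.
  apply: (ideal_sub_ideal _ it); last first.
  + by case: iI => _ [x Ix x0] _; exists x => //; exact: sub_w_op.
  + exact: w_op_sub_t.
  + have mM M : t_Max D M -> submod D (ext M I).
      move=> tM; apply: (submod_loc hD (t_Max_prime tM)).
      by apply: (submod_ext hD (t_Max_prime tM)); exact: ideal_submod.
    split=> [M /mM[]//|x y wx wy M tM|a x Da wx M tM].
      by have [_ + _] := mM M tM; apply; [exact: wx|exact: wy].
    by have [_ _] := mM M tM; apply => //; exact: wx.
- move=> I J x iI iJ Hx y wy M tM; have hM := t_Max_prime tM.
  have := wy M tM => /(extP hD hM _ (ideal_submod iI))[i [s [Ii Ds nMs ->]]].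
  rewrite mulrA mulrC; have [_ _] := submod_ext hD hM (ideal_submod iJ).
  by apply; [exact: loc_inv|exact: Hx].
- move=> x /(w_op_sub_t (ideal_unit hD)).
  by case: star_t => _ _ _; apply.
Qed.

Lemma w_op_local I x : is_ideal D I ->
  (forall M, t_Max D M -> ext M (w_op D I) x) -> w_op D I x.
Proof. by move=> iI Hx M tM; rewrite -w_op_ext //; exact: Hx. Qed.

(* The intersections of more and more t-maximal ideals through d form a
   descending chain, and their duals, scaled by d, an ascending chain of
   integral divisorial ideals. *)
Lemma t_Max_finite_character d : D d -> d != 0 ->
  exists l : seq (set K), forall M, t_Max D M -> M d -> List.In M l.
Proof.
move=> Dd d0; apply: contrapT => noL.
(* If no finite list suffices, [f] supplies a further t-maximal ideal through d for each list. *)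
have /choice[f fP] : forall l : seq (set K), exists M,
    [/\ t_Max D M, M d & ~ List.In M l].
  move=> l; apply: contrapT => noM; apply: noL; exists l => M tM Md.
  by apply: contrapT => Ml; apply: noM; exists M.
pose s n := iter n (fun l => f l :: l) [::].
have sP n M : List.In M (s n) -> t_Max D M /\ M d.
  elim: n => [|n IH] //= [<-|/IH//].
  by case: (fP (s n)).
pose B n := [set x | D x /\ forall M, List.In M (s n) -> M x].
have iB n : is_ideal D (B n).
  apply: (ideal_sub_ideal _ (ideal_unit hD)) => [|x []//|].
    have [D0 _ DD DM _] := hD; split=> [|x y [Dx Bx] [Dy By]|a x Da [Dx Bx]].
    + split=> // M /sP[tM _].
      by case: (ideal_submod (t_Max_ideal tM)).
    + split=> [|M Ml]; first exact: DD.
      have [tM _] := sP _ _ Ml; have [_ + _] := ideal_submod (t_Max_ideal tM).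
      by apply; [exact: Bx|exact: By].
    + split=> [|M Ml]; first exact: DM.
      have [tM _] := sP _ _ Ml; have [_ _] := ideal_submod (t_Max_ideal tM).
      by apply=> //; exact: Bx.
  by exists d => //; split=> // M /sP[].
have iC n : is_ideal D [set x | B n (d * x)] by exact: ideal_scale.
have [n|n x Hx y [Dy By]|N /(_ N.+1 (leqnSn N)) AE] :=
  D_mori (I := fun n => colon D [set x | B n (d * x)]).
(* The dual is integral because d is in [B n], so 1 is in d^-1 [B n]; a dual is its own
   v-closure. *)
- have iA := ideal_colon hD (ideal_unit hD) (iC n).
  split; last first.
    move=> x Hx; rewrite -[x]mulr1; apply: Hx => /=; rewrite mulr1.
    by split=> // M /sP[].
  split=> //; apply/seteqP; split; first exact: v_op_sub.
  by move=> x Hx y Cy; apply: Hx => z; rewrite mulrC; exact.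
- by apply: Hx; split=> // M Ml; apply: By; right.
have [tM Md Ml] := fP (s N); set M := f (s N) in tM Md Ml.
(* Once the duals agree, [B N] lies in the v-closure of [B N.+1], hence in that of M, which is M
   itself. *)
have BM : B N `<=` M.
  move=> x Bx; rewrite -(t_Max_closed tM) (mori_t_eq_v (t_Max_ideal tM)).
  apply: (@v_op_mono _ _ (B N.+1)); first by move=> y [_]; apply; left.
  move=> y Hy; have : colon D [set x | B N.+1 (d * x)] (d * y).
    by move=> z Bz; rewrite mulrAC mulrC; apply: Hy.
  rewrite AE => /(_ (x / d)) /=.
  have -> : d * (x / d) = x by field.
  have -> : d * y * (x / d) = x * y by field.
  exact.
have hM := t_Max_prime tM; have [M0 M1 MM] := hM.
(* Contradiction by primality: each t-maximal P other than M has an element outside M, and the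
   product of these elements lies in every P of the list but not in M. *)
have avoid (l : seq (set K)) : (forall N, List.In N l -> t_Max D N) ->
    ~ List.In M l ->
    exists x, [/\ D x, ~ M x & forall N, List.In N l -> N x].
  elim: l => [|P l IH] lP Ml'; first by exists 1; split=> //; case: hD.
  have [|l1|x [Dx nMx lx]] := IH; [by move=> N' Nl; apply: lP; right
    |by apply: Ml'; right|].
  have tP : t_Max D P by apply: lP; left.
  have [y Py nMy] : exists2 y, P y & ~ M y.
    apply: contrapT => noy; apply: Ml'; left.
    have [PP maxP] := tP; symmetry; apply: maxP; first by case: tM.
    by move=> y Py; apply: contrapT => nMy; apply: noy; exists y.
  have Dy : D y by case: tP => [[[_ sP'] _] _]; exact: sP'.
  have [_ _ DDx DM _] := hD.
  exists (x * y); split; first exact: DM.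
    by move=> /(MM _ _ Dx Dy)[].
  move=> N' [<-|N'l].
    by have [_ _] := ideal_submod (t_Max_ideal tP); apply.
  have tN' : t_Max D N' by apply: lP; right.
  have [_ _] := ideal_submod (t_Max_ideal tN'); rewrite mulrC; apply=> //.
  exact: lx.
have [N' /sP[]//|x [Dx nMx lx]] := avoid (s N) _ Ml.
by apply/nMx/BM; split.
Qed.

(* Locally at N, stability makes I D_N finitely generated over its
   endomorphism ring, so that one denominator serves at N; by finite character
   only finitely many N matter. *)
Lemma w_stable_colon_localizes M I :
  (forall N, t_Max D N -> star_stable d_op (loc D N)) ->
  t_Max D M -> is_ideal D I -> colon_localizes D w_op I M.
Proof.
move=> stab tM iI y; rewrite w_op_ext // => Hy.
have hM := t_Max_prime tM; have [M0 M1 MM] := hM.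
have [D0 D1 DD DM _] := hD; have mI := ideal_submod iI.
have iII := ideal_idealM hD iI iI.
pose good N s := forall z, idealM I I z -> ext N I (s * y * z).
have goodM N s t : t_Max D N -> D t -> good N s -> good N (t * s).
  move=> tN Dt gs z Iz; have hN := t_Max_prime tN.
  have [_ _ H] := submod_loc hD hN (submod_ext hD hN mI).
  by rewrite -!mulrA; apply: H => //; rewrite mulrA; exact: gs.
have local_good N : t_Max D N -> exists s, [/\ D s, ~ M s & good N s].
  move=> tN; have hN := t_Max_prime tN; have hL := loc_fractions hD hN.
  have iX := ideal_ext hD hN iI.
  set X := ext N I in iX; pose Q := colon X (idealM X X).
  have mQ : submod (loc D N) Q by apply: submod_colon; exact: ideal_submod.
  have : idealM X Q 1 by apply/(star_stableP hL (star_d _) iX)/stab.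
  (* Denominators are moved into Q, a D_N-module, so that 1 = sum of i_k q_k with every i_k in I
     itself. *)
  have sIQ : idealM X Q `<=` idealM I Q.
    apply: (idealM_sub (submod_idealM Q mI)) => x q.
    move=> /(extP hD hN _ mI)[i [t [Ii Dt nNt ->]]] Qq.
    rewrite -mulrA; apply: mem_idealM => //; case: mQ => _ _; apply=> //.
    exact: loc_inv.
  move=> /sIQ[n [i [q [Ii Qq one]]]].
  (* A denominator s outside M brings the finitely many elements y i_k i_l into I. *)
  have [[k l]|s [Ds nMs sI]] := @common_denominator _ _ hD _ hM I _
      (fun kl : 'I_n * 'I_n => y * (i kl.1 * i kl.2)) mI.
    by apply: Hy; exact: mem_idealM.
  exists s; split=> //.
  have mB := submod_preim_mull (s * y) (ideal_submod iX).
  suff : idealM I I `<=` [set z | X (s * y * z)] by [].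
  apply: (idealM_sub (submod_loc hD hN mB)) => u v Iu Iv /=.
  (* The relation 1 = sum of i_k q_k is inserted twice. Each s y i_k i_l lies in I, and since Q
     carries X^2 into X, multiplying by v q_l and then by u q_k stays in X. *)
  have -> : s * y * (u * v) = \sum_(k < n) \sum_(l < n)
      q k * (u * (q l * (v * (s * (y * (i k * i l)))))).
    rewrite -[LHS]mulr1 -[1](mulr1 1) {1 2}one big_distrlr /= mulr_sumr.
    apply: eq_bigr => k _; rewrite mulr_sumr; apply: eq_bigr => l _.
    by ring.
  have XI : I `<=` X by exact: (sub_ext hD hN).
  apply: (submod_sum (ideal_submod iX)) => k.
  apply: (submod_sum (ideal_submod iX)) => l.
  apply: (Qq k); apply: mem_idealM; first exact: XI.
  by apply: (Qq l); apply: mem_idealM; [exact: XI|apply/XI/(sI (k, l))].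
(* A nonzero d in D with d y I^2 inside I: at every N avoiding d any s is good, so only the N
   through d remain. *)
have iQy := ideal_colon_elt hD y (ideal_colon hD iI iII).
have [_ [d [Dd Qd] d0] _] := iQy.
have [l lP] := t_Max_finite_character Dd d0.
(* The local denominators are multiplied over the finite list; the product stays outside M because M
   is prime. *)
have [s [Ds nMs ls]] : exists s, [/\ D s, ~ M s &
    forall N, t_Max D N -> List.In N l -> good N s].
  elim: (l) => [|P l' [s [Ds nMs ls]]]; first by exists 1.
  have [tP|ntP] := pselect (t_Max D P); last first.
    by exists s; split=> // N tN [PN|]; [case: ntP; rewrite PN|exact: ls].
  have [t [Dt nMt tG]] := local_good _ tP.
  exists (s * t); split; [exact: DM|by move=> /(MM _ _ Ds Dt)[]|].
  move=> N tN [<-|Nl]; first exact: goodM.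
  by rewrite mulrC; apply: goodM => //; exact: ls.
exists s; split=> // z Iz N tN; have hN := t_Max_prime tN.
have [Nd|nNd] := pselect (N d); first by apply: ls => //; exact: lP.
have -> : s * y * z = s * (d * y * z) / d by field.
apply: mem_ext => //; have [_ _] := mI; apply=> //; exact: Qd.
Qed.

End Mori.

(** * The field of fractions of R, and the theorem *)

Lemma fraction_div (R : idomainType) (x : {fraction R}) :
  exists a b : R, b != 0 /\ x = FracField.tofrac a / FracField.tofrac b.
Proof.
elim/quotW: x => y; exists (frac y).1, (frac y).2; split.
  exact: denom_ratioP.
have b0 : FracField.tofrac (frac y).2 != 0 by rewrite tofrac_eq0 denom_ratioP.
(* It remains to check x b = a on representatives of the quotient. *)
apply: (canRL (mulfK b0)); rewrite [LHS]piE /FracField.tofrac; unlock.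
apply/eqmodP; rewrite /= FracField.equivfE /FracField.mulf.
rewrite !numden_Ratio ?mulf_neq0 ?oner_eq0 ?denom_ratioP //.
by rewrite !mulr1 mulrC.
Qed.

Lemma base_domain_fractions (R : idomainType) :
  subring_with_fractions (base_domain R).
Proof.
split.
- by exists 0 => //; rewrite rmorph0.
- by exists 1 => //; rewrite rmorph1.
- by move=> _ _ [a _ <-] [b _ <-]; exists (a + b) => //; rewrite rmorphD.
- by move=> _ _ [a _ <-] [b _ <-]; exists (a * b) => //; rewrite rmorphM.
- move=> x; have [a [b [b0 ->]]] := fraction_div x.
  exists (FracField.tofrac a), (FracField.tofrac b).
  split=> //; [by exists a|by exists b|by rewrite tofrac_eq0].
Qed.

Theorem proposition2p5 (R : idomainType)
    (hR : mori (base_domain R)) :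
  (* (1) *)
  [/\ clifford_regular t_op (base_domain R) <->
      (forall M : set {fraction R}, t_Max (base_domain R) M ->
         clifford_regular t_op (loc (base_domain R) M)),
      star_stable t_op (base_domain R) <->
      (forall M : set {fraction R}, t_Max (base_domain R) M ->
         star_stable t_op (loc (base_domain R) M))
    & star_stable w_op (base_domain R) <->
      (forall M : set {fraction R}, t_Max (base_domain R) M ->
         star_stable d_op (loc (base_domain R) M))]
  /\
  (* (2) *)
  (clifford_regular w_op (base_domain R) ->
     forall M : set {fraction R}, t_Max (base_domain R) M ->
       clifford_regular d_op (loc (base_domain R) M))
  /\
  (strong_mori (base_domain R) ->
     (clifford_regular w_op (base_domain R) <->
      (forall M : set {fraction R}, t_Max (base_domain R) M ->
         clifford_regular d_op (loc (base_domain R) M)))).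
Proof.
have hD := base_domain_fractions R; set D := base_domain R in hR hD *.
have hT := t_Max_prime hD hR.
have t_star := star_t hD hR; have t_starL := star_t_loc hD hR.
have t_ext := t_op_ext hD hR; have t_local := t_op_local hD hR.
have w_star := star_w hD hR; have w_local := w_op_local hD hR.
(* The local partner of w is d, because I^w D_M = I D_M. *)
have w_ext M I : t_Max D M -> is_ideal D I ->
    d_op (loc D M) (idealM I (loc D M)) = idealM (w_op D I) (loc D M).
  by move=> tM iI; rewrite w_op_ext.
have d_star M : t_Max D M -> star (loc D M) d_op by move=> _; exact: star_d.
have t_cl M I : t_Max D M -> is_ideal D I -> colon_localizes D t_op I M.
  move=> tM iI; have iII := ideal_idealM hD iI iI.
  have [J [fgJ sJ sI]] := t_finite_type hD hR iII.
  exact: (finite_type_colon_localizes hD hT t_star tM iI fgJ sJ sI).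
have w_regular := regular_localizes hD hT w_ext.
split; last split=> //.
  split; split.
  - exact: (regular_localizes hD hT t_ext).
  - exact: (regular_of_local hD hT t_star t_starL t_ext t_local t_cl).
  - exact: (stable_localizes hD hT t_star t_starL t_ext).
  - exact: (stable_of_local hD hT t_star t_starL t_ext t_local t_cl).
  - exact: (stable_localizes hD hT w_star d_star w_ext).
  - move=> stab; apply: (stable_of_local hD hT w_star d_star w_ext w_local) => //.
    by move=> M I; exact: w_stable_colon_localizes.
move=> smori; split=> // reg.
apply: (regular_of_local hD hT w_star d_star w_ext w_local) => // M I tM iI.
have iII := ideal_idealM hD iI iI.
(* Strong Mori enters here: it yields a finitely generated J inside I^2 whose w-closure contains
   I^2. *)
have [J [fgJ sJ sI]] := finite_type_of_acc hD w_star smori iII.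
exact: (finite_type_colon_localizes hD hT w_star tM iI fgJ sJ sI).
Qed.
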